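(* Let $0<\mu\le L$ and let $f\in C^2(\mathbb{R}^d)$ be convex with $\mu I\preceq\nabla^2f(\mathbf{x})\preceq LI$ for all $\mathbf{x}\in\mathbb{R}^d$, with minimizer $\mathbf{x}_*$. Let $\epsilon>0$, $c:=\frac{2\sqrt{\mu L}}{\mu+L}$, let $\Phi:\mathbb{R}^d\to\mathbb{R}$ be a Legendre function, and let $t\ge2$. Run the finite-difference procedure (defined in the context) from $\mathbf{x}_1\in\mathbb{R}^d$ with admissible stepsizes $\eta_j>0$, and suppose that every performed step satisfies $$\eta_jD_{f,\Omega_{\epsilon,c}}(\mathbf{x}_{j+1}\|\mathbf{x}_j)\le D_\Phi(\mathbf{x}_{j+1}\|\mathbf{x}_j).$$ Then either the procedure first stops at an index $\tau\le t$, in which case $$f(\mathbf{x}_\tau)-f(\mathbf{x}_* )\le\sup_{\mathbf{x}\in V_{\epsilon,c}}\bigl(f(\mathbf{x})-f(\mathbf{x}_* )\bigr),$$ or no stopping occurs through $\mathbf{x}_t$, in which case $$f(\mathbf{x}_t)-f(\mathbf{x}_* )\le\frac{D_\Phi(\mathbf{x}_*\|\mathbf{x}_1)}{\sum_{j=1}^{t-1}\eta_j}.$$ Equivalently, for the returned point $\widehat{\mathbf{x}}_t$, equal to the first stopping point $\mathbf{x}_\tau$ if one occurs with $\tau\le t$ and to $\mathbf{x}_t$ otherwise, $$f(\widehat{\mathbf{x}}_t)-f(\mathbf{x}_* )\le\max\left\{\frac{D_\Phi(\mathbf{x}_*\|\mathbf{x}_1)}{\sum_{j=1}^{t-1}\eta_j},\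 \sup_{\mathbf{x}\in V_{\epsilon,c}}\bigl(f(\mathbf{x})-f(\mathbf{x}_* )\bigr)\right\},$$ where the first term is omitted if stopping occurs before it is needed.
   Context: Let $\mathbf{e}_i$ be the standard basis vectors. For $\epsilon>0$ define $m_i(\mathbf{x}):=\frac{f(\mathbf{x}+\epsilon\mathbf{e}_i)-f(\mathbf{x}-\epsilon\mathbf{e}_i)}{2\epsilon}$, $r_i(\mathbf{x}):=\frac{f(\mathbf{x}+\epsilon\mathbf{e}_i)+f(\mathbf{x}-\epsilon\mathbf{e}_i)-2f(\mathbf{x})}{2\epsilon}$, $M(\mathbf{x}):=\|\mathbf{m}(\mathbf{x})\|_2$, $R(\mathbf{x}):=\|\mathbf{r}(\mathbf{x})\|_2$. For $c\in(0,1]$, $V_{\epsilon,c}:=\{\mathbf{x}:M(\mathbf{x})\le R(\mathbf{x})/c\}$, and for $\mathbf{x}\notin V_{\epsilon,c}$, $\Omega_{\epsilon,c}(\mathbf{x}):=\alpha(\mathbf{x})\mathbf{m}(\mathbf{x})$ with $\alpha(\mathbf{x}):=\frac{c(M(\mathbf{x})^2-R(\mathbf{x})^2)}{M(\mathbf{x})(cM(\mathbf{x})-R(\mathbf{x}))}$. Finite-difference procedure: at iterate $\mathbf{x}_j$, if $\mathbf{x}_j\in V_{\epsilon,c}$ the procedure stops at $\mathbf{x}_j$; otherwise, with a stepsize $\eta_j>0$ that is admissible, i.e. $\nabla\Phi(\mathbf{x}_j)-\eta_j\Omega_{\epsilon,c}(\mathbf{x}_j)\in\operatorname{int}\operatorname{dom}\Phi^*$,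 it performs the step $\mathbf{x}_{j+1}=\nabla\Phi^*(\nabla\Phi(\mathbf{x}_j)-\eta_j\Omega_{\epsilon,c}(\mathbf{x}_j))$. Here $\Phi^*$ is the convex conjugate; for a Legendre function (closed proper convex, essentially smooth, essentially strictly convex) $\nabla\Phi$ is one-to-one with inverse $\nabla\Phi^*$ on $\operatorname{int}\operatorname{dom}\Phi^*$. $D_\Phi(\mathbf{x}\|\mathbf{y})=\Phi(\mathbf{x})-\Phi(\mathbf{y})-\langle\nabla\Phi(\mathbf{y}),\mathbf{x}-\mathbf{y}\rangle$ and $D_{f,\Omega}(\mathbf{x}\|\mathbf{y})=\langle\Omega(\mathbf{y}),\mathbf{y}-\mathbf{x}\rangle-f(\mathbf{y})+f(\mathbf{x})$. ''First term omitted'' means that if the procedure stops at an index $\tau\le t$, so that the sum of stepsizes up to $t-1$ need not be defined, the bound is by the supremum alone. *)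

(* Defs.v *)
From HB Require Import structures.
From mathcomp Require Import all_boot all_order all_algebra.
From mathcomp Require Import all_classical all_reals all_analysis.

Set Implicit Arguments.
Unset Strict Implicit.
Unset Printing Implicit Defensive.

Import Order.TTheory GRing.Theory Num.Theory.
Import numFieldNormedType.Exports.

Local Open Scope classical_set_scope.
Local Open Scope ring_scope.

(* Points of R^d are row vectors. The norm MathComp-Analysis puts on
   'rV[R]_d is the sup norm, so the Euclidean norm is defined separately; both
   induce the same topology. *)

Section Euclidean.
Context {R : realType} {d : nat}.
Implicit Types (u v x y : 'rV[R]_d) (A B : 'M[R]_d).

Definition dot u v : R := \sum_(i < d) u 0 i * v 0 i.

Definition norm2 u : R := Num.sqrt (\sum_(i < d) u 0 i ^+ 2).

Definition basis_vec (i : 'I_d) : 'rV[R]_d := delta_mx 0 i.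

Definition partial (i : 'I_d) (f : 'rV[R]_d -> R^o) (x : 'rV[R]_d) : R^o :=
  'D_(basis_vec i) f x.

Definition grad (f : 'rV[R]_d -> R^o) x : 'rV[R]_d := \row_i partial i f x.

Definition hessian (f : 'rV[R]_d -> R^o) x : 'M[R]_d :=
  \matrix_(i, j) partial i (partial j f) x.

Definition C2 (f : 'rV[R]_d -> R^o) : Prop :=
  [/\ forall x i, derivable f x (basis_vec i),
      forall i, continuous (partial i f),
      forall x i j, derivable (partial j f) x (basis_vec i) &
      forall i j, continuous (partial i (partial j f))].

Definition psd A : Prop := A^T = A /\ forall v, 0 <= dot (v *m A) v.

Definition loewner_le A B : Prop := psd (B - A).

Definition minimizer (f : 'rV[R]_d -> R) xs : Prop := forall x, f xs <= f x.

End Euclidean.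

(* Extended-real-valued convex analysis, following Rockafellar. *)

Section ConvexAnalysis.
Context {R : realType} {d : nat}.
Local Notation E := 'rV[R]_d.
Implicit Types (F : E -> \bar R) (x y g : E).

Definition edom F : set E := [set x | (F x < +oo)%E].

Definition proper F : Prop := (forall x, F x != -oo%E) /\ edom F !=set0.

Definition epigraph F : set (E * R^o)%type := [set p | (F p.1 <= p.2%:E)%E].

Definition econvex F : Prop := convex_set (epigraph F).

Definition subdifferential F x : set E :=
  [set g | forall y, (F x + (dot g (y - x))%:E <= F y)%E].

Definition dom_subdifferential F : set E :=
  [set x | subdifferential F x !=set0].

Definition strictly_convex_on (C : set E) F : Prop :=
  forall x y (t : R), C x -> C y -> x != y -> 0 < t < 1 ->
    (F (t *: x + (1 - t) *: y)%R < t%:E * F x + (1 - t)%:E * F y)%E.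

Definition essentially_strictly_convex F : Prop :=
  forall C : set E, convex_set C -> C `<=` dom_subdifferential F ->
    strictly_convex_on C F.

(* Only meaningful where [F] is finite. *)
Definition egrad F : E -> E := grad (fun x => fine (F x)).

Definition essentially_smooth F : Prop :=
  let C := (edom F)° in
  [/\ C !=set0,
      forall x, C x -> differentiable (fun y => fine (F y) : R^o) x &
      forall (u : nat -> E) x,
        (forall n, C (u n)) -> u @ \oo --> x -> (closure C `\` C) x ->
        norm2 (egrad F (u n)) @[n --> \oo] --> +oo].

(* For a proper function, closed means lower semicontinuous. *)
Definition legendre F : Prop :=
  [/\ proper F, econvex F, lower_semicontinuous F,
      essentially_smooth F & essentially_strictly_convex F].

Definition conjugate F y : \bar R :=
  ereal_sup [set ((dot y x)%:E - F x)%E | x in setT].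

End ConvexAnalysis.

Section Divergences.
Context {R : realType} {d : nat}.
Local Notation E := 'rV[R]_d.

Definition bregman (Phi : E -> R) (x y : E) : R :=
  Phi x - Phi y - dot (grad Phi y) (x - y).

Definition gen_bregman (f : E -> R) (Omega : E -> E) (x y : E) : R :=
  dot (Omega y) (y - x) - f y + f x.

End Divergences.

Section FiniteDifferences.
Context {R : realType} {d : nat}.
Local Notation E := 'rV[R]_d.
Variables (f : E -> R) (eps c : R).
Implicit Types x : E.

Definition fd_m x : E :=
  \row_i ((f (x + eps *: basis_vec i) - f (x - eps *: basis_vec i))
          / (2 * eps)).

Definition fd_r x : E :=
  \row_i ((f (x + eps *: basis_vec i) + f (x - eps *: basis_vec i) - 2 * f x)
          / (2 * eps)).

Definition fd_M x : R := norm2 (fd_m x).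

Definition fd_R x : R := norm2 (fd_r x).

Definition fd_V : set E := [set x | fd_M x <= fd_R x / c].

Definition fd_alpha x : R :=
  c * (fd_M x ^+ 2 - fd_R x ^+ 2) / (fd_M x * (c * fd_M x - fd_R x)).

(* Only meaningful outside [fd_V]. *)
Definition fd_Omega x : E := fd_alpha x *: fd_m x.

End FiniteDifferences.

Section Procedure.
Context {R : realType} {d : nat}.
Local Notation E := 'rV[R]_d.

Definition no_stop_through (V : set E) (x : nat -> E) (k : nat) : Prop :=
  forall j, (1 <= j <= k)%N -> ~ V (x j).

Definition first_stop (V : set E) (x : nat -> E) (tau : nat) : Prop :=
  [/\ (1 <= tau)%N, V (x tau) & no_stop_through V x tau.-1].

Definition dual_step (Phi : E -> R) (Omega : E -> E) (eta : R) (x : E) : E :=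
  grad Phi x - eta *: Omega x.

Definition admissible (Phi : E -> R) (Omega : E -> E) (x : E) (eta : R) : Prop :=
  (edom (conjugate (EFin \o Phi)))° (dual_step Phi Omega eta x).

Definition mirror_step (Phi : E -> R) (Omega : E -> E) (eta : R) (x : E) : E :=
  egrad (conjugate (EFin \o Phi)) (dual_step Phi Omega eta x).

(* The step from iterate [j] to iterate [j.+1] is one of the steps carried out
   in computing iterate [t]. Indices start at 1. *)
Definition performed (V : set E) (x : nat -> E) (t j : nat) : Prop :=
  (1 <= j < t)%N /\ no_stop_through V x j.

(* [x] and [eta] are total sequences; their values past the first stopping
   index, or past [t], are unconstrained and play no role. *)
Definition fd_run (f Phi : E -> R) (eps c : R) (t : nat)
    (x : nat -> E) (eta : nat -> R) : Prop :=
  forall j, performed (fd_V f eps c) x t j ->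
    [/\ 0 < eta j,
        admissible Phi (fd_Omega f eps c) (x j) (eta j) &
        x j.+1 = mirror_step Phi (fd_Omega f eps c) (eta j) (x j)].

(* [find] returns [t] when no index of [iota 1 t] is a stopping index, and
   [tau - 1] when the first one is [tau]. *)
Definition returned_point (V : set E) (x : nat -> E) (t : nat) : E :=
  x (minn t (find (fun j => `[< V (x j) >]) (iota 1 t)).+1).

Definition sup_gap (f : E -> R) (xs : E) (V : set E) : \bar R :=
  ereal_sup [set (f x - f xs)%:E | x in V].

End Procedure.

(* Main.v *)
(* Convexity of [f] along the coordinate lines gives [|m_i - g_i| <= r_i] for
   the gradient [g] of [f], hence [|m - g| <= R]. The bounds on the Hessian make
   the cosine of the angle between [g x] and [x - xs] at least [c]. Outside
   [V_(eps,c)] the factor [alpha] is large enough that these two facts alone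
   imply [<g, x - xs> <= <alpha m, x - xs>], so that
   [f x - f xs <= <Omega x, x - xs>]: relative to the minimizer, [Omega] behaves
   like a gradient. The step inequality then yields, by the three-point identity
   for [D_Phi], both [f (x j.+1) <= f (x j)] and
   [eta j * (f (x j.+1) - f xs) <= D_Phi xs (x j) - D_Phi xs (x j.+1)], and the
   latter telescopes. The three-point identity needs
   [grad Phi (x j.+1) = grad Phi (x j) - eta j *: Omega (x j)], i.e. that
   [grad Phi^*] inverts [grad Phi] on the interior of the domain of [Phi^*]. *)
Require Import Defs.
From mathcomp Require Import all_boot all_order all_algebra.
From mathcomp Require Import all_classical all_reals all_analysis.
From mathcomp Require Import ring lra zify.

Set Implicit Arguments.
Unset Strict Implicit.
Unset Printing Implicit Defensive.

Import Order.TTheory GRing.Theory Num.Theory.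
Import numFieldNormedType.Exports.

Local Open Scope classical_set_scope.
Local Open Scope ring_scope.

(** * Directional derivatives *)

Section DirectionalDerivatives.
Context {R : realType}.

(** Clearing the denominator makes the estimate hold at [h = 0] too, so it can be combined and
    rescaled without excluding that point. *)
Lemma is_deriveP {V : normedModType R} (f : V -> R^o) (x v : V) (l : R^o) :
  is_derive x v f l <->
  forall e : R, 0 < e -> exists2 k : R, 0 < k &
    forall h : R, `|h| < k -> `|f (h *: v + x) - f x - h * l| <= e * `|h|.
Proof.
split=> [[df <-] e e0|fl].
  have /cvgrPdist_le/(_ e e0) := df.
  rewrite near_withinE => /nbhs_ballP[k /= k0 dk]; exists k => // h hk.
  have [->|h0] := eqVneq h 0.
    by rewrite scale0r add0r subrr mul0r subrr !normr0 mulr0.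
  have := dk h; rewrite -ball_normE /= sub0r normrN => /(_ hk h0) {}dk.
  have -> : f (h *: v + x) - f x - h * 'D_v f x =
    - (h * ('D_v f x - h^-1 *: (f (h *: v + x) - f x))).
    by rewrite /GRing.scale/=; field.
  by rewrite normrN normrM mulrC ler_wpM2r.
have cl : (fun h => h^-1 *: ((f \o shift x) (h *: v) - f x)) @ 0^' --> l.
  apply/cvgrPdist_le => e /fl[k k0 fk]; rewrite near_withinE.
  apply/nbhs_ballP; exists k => //= h; rewrite -ball_normE /= sub0r normrN.
  move=> /fk + h0; have -> : f (h *: v + x) - f x - h * l =
    - (h * (l - h^-1 *: (f (h *: v + x) - f x))).
    by rewrite /GRing.scale/=; field.
  by rewrite normrN normrM mulrC ler_pM2r ?normr_gt0.
by split; [apply/cvg_ex; exists l|exact: cvg_lim].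
Qed.


(** Small positive [h] gives [k <= l] and small negative [h] gives [l <= k]: a line that supports
    [f] at [x] is tangent to it. *)
Lemma is_derive_ge_eq {V : normedModType R} (f : V -> R^o) (x v : V) (l k : R) :
  is_derive x v f l -> (forall h : R, h * k <= f (h *: v + x) - f x) -> l = k.
Proof.
move=> /is_deriveP fl fk; apply/eqP; rewrite eq_le; apply/andP; split;
  apply/ler_addgt0Pl => e /fl[r r0 fr];
  have [s s0 sr] : exists2 s : R, 0 < s & s < r
    by exists (r / 2); [rewrite divr_gt0|lra].
- have := fr (- s); have := fk (- s); rewrite normrN gtr0_norm// => fk' /(_ sr).
  rewrite ler_norml => /andP[_ fr']; rewrite -(ler_pM2l s0); lra.
- have := fr s; have := fk s; rewrite gtr0_norm// => fk' /(_ sr).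
  rewrite ler_norml => /andP[_ fr']; rewrite -(ler_pM2l s0); lra.
Qed.

Lemma taylor2_ge (p p1 p2 : R -> R^o) (k : R) :
  (forall t : R, is_derive t 1 p (p1 t)) ->
  (forall t : R, is_derive t 1 p1 (p2 t)) ->
  (forall t, k <= p2 t) -> p 0 + p1 0 + k / 2 <= p 1.
Proof.
move=> dp dp1 kp2.
have cont (g g1 : R -> R^o) (a b : R) :
    (forall t : R, is_derive t 1 g (g1 t)) -> {within `[a, b], continuous g}.
  move=> dg; apply: derivable_within_continuous => t _.
  by have [] := dg t.
pose q (t : R) : R^o := p t - p1 0 * t - k / 2 * t ^+ 2.
pose q1 (t : R) : R^o := p1 t - p1 0 - k * t.
(* Removing the quadratic Taylor part leaves [q]. The mean value theorem for [p1] shows [q1 >= 0] on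
   [[0, 1]], and for [q] it then gives [q 0 <= q 1]. *)
have dq (t : R) : is_derive t 1 q (q1 t).
  have := dp t => dpt; apply: is_derive_eq.
  by rewrite /q1 /GRing.scale/= ; field.
have [c /itvP c01 qc] := @MVT_segment _ q q1 0 1 ler01
  (fun t _ => dq t) (cont _ _ 0 1 dq).
have c0 : 0 <= c by rewrite c01.
have [s _ ps] := @MVT_segment _ p1 p2 0 c c0
  (fun t _ => dp1 t) (cont _ _ 0 c dp1).
have : 0 <= q 1 - q 0.
  rewrite qc subr0 mulr1 /q1 ps subr0 -mulrBl mulr_ge0// subr_ge0; exact: kp2.
rewrite /q; lra.
Qed.

End DirectionalDerivatives.

(** * Euclidean geometry and gradients *)

Section EuclideanSpace.
Context {R : realType} {d : nat}.
Implicit Types (u v w x y : 'rV[R]_d) (a : R).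

Lemma dotC u v : dot u v = dot v u.
Proof. by apply: eq_bigr => i _; rewrite mulrC. Qed.

Lemma dotDl u v w : dot (u + v) w = dot u w + dot v w.
Proof. by rewrite -big_split; apply: eq_bigr => i _; rewrite mxE mulrDl. Qed.

Lemma dotZl a u v : dot (a *: u) v = a * dot u v.
Proof. by rewrite mulr_sumr; apply: eq_bigr => i _; rewrite mxE mulrA. Qed.

Lemma dotDr u v w : dot w (u + v) = dot w u + dot w v.
Proof. by rewrite dotC dotDl !(dotC w). Qed.

Lemma dotZr a u v : dot u (a *: v) = a * dot u v.
Proof. by rewrite dotC dotZl dotC. Qed.

Lemma dotNl u v : dot (- u) v = - dot u v.
Proof. by rewrite -scaleN1r dotZl mulN1r. Qed.

Lemma dotNr u v : dot u (- v) = - dot u v.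
Proof. by rewrite dotC dotNl dotC. Qed.

Lemma dot0r u : dot u 0 = 0.
Proof. by rewrite -(scale0r 0) dotZr mul0r. Qed.

Definition dotE := (dotDl, dotDr, dotNl, dotNr, dotZl, dotZr).

Lemma dot_basis_vec u i : dot u (basis_vec i) = u 0 i.
Proof.
rewrite /dot (bigD1 i)//= mxE !eqxx mulr1 big1 ?addr0// => j ji.
by rewrite mxE eqxx (negbTE ji) mulr0.
Qed.

Lemma dot_ge0 u : 0 <= dot u u.
Proof. by apply: sumr_ge0 => i _; rewrite -expr2 sqr_ge0. Qed.

Lemma dot_eq0 u : (dot u u == 0) = (u == 0).
Proof.
apply/idP/eqP => [|->]; last by rewrite /dot big1// => i _; rewrite mxE mul0r.
rewrite psumr_eq0 => [/allP u0|i _]; last by rewrite -expr2 sqr_ge0.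
apply/rowP => i; rewrite mxE; apply/eqP.
by rewrite -sqrf_eq0 expr2; apply: u0; rewrite mem_index_enum.
Qed.

Lemma norm2E u : norm2 u = Num.sqrt (dot u u).
Proof. by congr Num.sqrt; apply: eq_bigr => i _; rewrite expr2. Qed.

Lemma norm2_ge0 u : 0 <= norm2 u.
Proof. exact: sqrtr_ge0. Qed.

Lemma sqr_norm2 u : norm2 u ^+ 2 = dot u u.
Proof. by rewrite norm2E sqr_sqrtr ?dot_ge0. Qed.

Lemma norm2_eq0 u : (norm2 u == 0) = (u == 0).
Proof. by rewrite -sqrf_eq0 sqr_norm2 dot_eq0. Qed.

Lemma cauchy_schwarz u v : `|dot u v| <= norm2 u * norm2 v.
Proof.
rewrite -ler_sqr ?nnegrE ?mulr_ge0 ?norm2_ge0// real_normK ?num_real//.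
rewrite exprMn !sqr_norm2.
have [->|v0] := eqVneq v 0.
  by rewrite !dot0r mulr0 expr0n.
have vp : 0 < dot v v by rewrite lt_def dot_eq0 v0 dot_ge0.
rewrite -subr_ge0 -(pmulr_rge0 _ vp).
have := dot_ge0 (dot v v *: u - dot u v *: v).
by rewrite !dotE (dotC v u); congr (_ <= _); ring.
Qed.

Lemma rV_norm_coord u i : `|u 0 i| <= `|u|.
Proof.
rewrite -[leRHS]/(mx_norm u) mx_normrE.
exact: (le_bigmax _ (fun ij : 'I_1 * 'I_d => `|u ij.1 ij.2|) (0, i)).
Qed.

Lemma rV_norm_le u a : 0 <= a -> (forall i, `|u 0 i| <= a) -> `|u| <= a.
Proof.
move=> a0 ua; rewrite -[leLHS]/(mx_norm u) mx_normrE.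
by apply/bigmax_leP; split=> // -[i j] _ /=; rewrite ord1.
Qed.

End EuclideanSpace.

(** * Directional derivatives from continuous partial derivatives *)

Section Gradients.
Context {R : realType} {d : nat}.
Implicit Types (f : 'rV[R]_d -> R^o) (u v x y : 'rV[R]_d).

(** The estimate is uniform in base points [z] near [x]. This lets increments along successive
    directions be chained, since each one moves the base point of the next. *)
Let rate_near f x v (l : R) := forall e : R, 0 < e -> exists2 k : R, 0 < k &
  forall (z : 'rV[R]_d) (h : R), `|z - x| < k -> `|h| < k ->
    `|f (z + h *: v) - f z - h * l| <= e * `|h|.

Let rate_near0 f x : rate_near f x 0 0.
Proof.
move=> e e0; exists 1 => // z h _ _.
by rewrite scaler0 addr0 subrr mulr0 subrr normr0 mulr_ge0// ltW.
Qed.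

Let rate_nearZ f x v l (a : R) :
  rate_near f x v l -> rate_near f x (a *: v) (a * l).
Proof.
move=> fl e e0; have a1 : 0 < `|a| + 1 by rewrite ltr_wpDl.
have [|k k0 fk] := fl (e / (`|a| + 1)); first exact: divr_gt0.
exists (k / (`|a| + 1)); first exact: divr_gt0.
move=> z h; rewrite !ltr_pdivlMr// => zk hk.
rewrite scalerA mulrA (le_trans (fk z (h * a) _ _))//.
- by rewrite (le_lt_trans _ zk)// ler_peMr// lerDr.
- by rewrite normrM (le_lt_trans _ hk)// ler_wpM2l// lerDl.
- rewrite normrM mulrAC ler_pdivrMr// mulrA.
  by rewrite ler_wpM2l ?mulr_ge0 ?(ltW e0)// lerDl.
Qed.

Let rate_nearD f x u v l k : rate_near f x u l -> rate_near f x v k ->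
  rate_near f x (u + v) (l + k).
Proof.
move=> fl fk e e0; have e2 : 0 < e / 2 by rewrite divr_gt0.
have [a a0 fa] := fl _ e2; have [b b0 fb] := fk _ e2.
have u1 : 1 <= `|u| + 1 by rewrite lerDr.
have u1' : 0 < `|u| + 1 by rewrite ltr_wpDl.
(* The path goes from [z] to [z + h *: u] and then along [v]; the second radius keeps the
   intermediate point within [b] of [x]. *)
exists (Num.min a (b / 2 / (`|u| + 1))); first by rewrite lt_min a0/= !divr_gt0.
move=> z h; rewrite !lt_min !ltr_pdivlMr// => /andP[za zb] /andP[ha hb].
have zhb : `|z + h *: u - x| < b.
  rewrite addrAC (le_lt_trans (ler_normD _ _))// normrZ.
  have : 0 <= `|z - x| by [].
  have : 0 <= `|h| by [].
  move: zb hb u1; nra.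
have hb' : `|h| < b.
  have : 0 <= `|h| by [].
  move: hb u1; nra.
rewrite scalerDr addrA.
have := lerD (fb _ _ zhb hb') (fa _ _ za ha).
rewrite -mulrDl -splitr; apply: le_trans; apply: le_trans (ler_normD _ _).
by rewrite le_eqVlt; apply/orP; left; apply/eqP; congr (`| _ |); ring.
Qed.

Let rate_near_basis f x i : (forall z, derivable f z (basis_vec i)) ->
  {for x, continuous (partial i f)} ->
  rate_near f x (basis_vec i) (partial i f x).
Proof.
move=> df cf e e0; set b := basis_vec i.
have /cvgrPdist_le/(_ e e0)/nbhs_ballP[k /= k0 fk] := cf.
have b1 : 0 < `|b| + 1 by rewrite ltr_wpDl.
have line z (s : R) : is_derive s 1 (fun t : R => f (z + t *: b) : R^o)
    (partial i f (z + s *: b)).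
  apply/is_deriveP => r r0; have /derivableP/is_deriveP := df (z + s *: b).
  move=> /(_ r r0)[q q0 fq]; exists q => // h /fq.
  by rewrite -[_%:A]/(h * 1) mulr1 scalerDl addrCA addrA.
have pos z (h : R) : 0 <= h -> `|z - x| + h * `|b| < k ->
    `|f (z + h *: b) - f z - h * partial i f x| <= e * h.
  move=> h0 zk.
  have [|t] := @MVT_segment _ (fun t : R => f (z + t *: b)) _ 0 h h0
    (fun t _ => line z t).
    apply: derivable_within_continuous => t _; by have [] := line z t.
  rewrite in_itv/= => /andP[t0 th]; rewrite scale0r addr0 subr0 => ->.
  rewrite mulrC -mulrBr normrM (ger0_norm h0) mulrC ler_wpM2r// distrC.
  apply: fk; rewrite -ball_normE /= distrC addrAC.
  rewrite (le_lt_trans (ler_normD _ _))// (le_lt_trans _ zk)// lerD2l normrZ.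
  by rewrite ler_wpM2r// ger0_norm.
exists (k / 2 / (`|b| + 1)); first by rewrite !divr_gt0.
move=> z h; rewrite !ltr_pdivlMr// => zk hk.
have zh : `|z - x| + `|h| * `|b| + `|h| * `|b| < k.
  have : 0 <= `|z - x| by [].
  have : 0 <= `|h| by [].
  have : 0 <= `|b| by [].
  move: zk hk; nra.
have [h0|/ltW h0] := leP 0 h.
  rewrite [X in _ <= _ * X]ger0_norm//; apply: pos => //.
  move: zh; rewrite (ger0_norm h0); have : 0 <= h * `|b| by rewrite mulr_ge0.
  lra.
(* For negative [h] the same segment is traversed backwards, from [z + h *: b] to [z]. *)
have := pos (z + h *: b) (- h).
rewrite oppr_ge0 => /(_ h0); rewrite scaleNr addrK (ler0_norm h0).
have -> : f (z + h *: b) - f z - h * partial i f x =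
  - (f z - f (z + h *: b) - - h * partial i f x) by ring.
rewrite normrN; apply; apply: le_lt_trans zh.
rewrite (ler0_norm h0) lerD2r addrAC.
by rewrite (le_trans (ler_normD _ _))// normrZ (ler0_norm h0).
Qed.

Lemma C1_is_derive f x v : (forall z i, derivable f z (basis_vec i)) ->
  (forall i, continuous (partial i f)) -> is_derive x v f (dot (grad f x) v).
Proof.
move=> df cf.
have : rate_near f x (\sum_i v 0 i *: basis_vec i)
    (\sum_i v 0 i * partial i f x).
  apply: (big_ind2 (fun w (l : R) => rate_near f x w l)).
  - exact: rate_near0.
  - by move=> u l w k; exact: rate_nearD.
  - by move=> i _; apply: rate_nearZ; apply: rate_near_basis => // z; exact: cf.
rewrite -row_sum_delta (_ : \sum_i _ = dot (grad f x) v); last first.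
  by apply: eq_bigr => i _; rewrite mxE mulrC.
move=> fl; apply/is_deriveP => e /fl[k k0 fk]; exists k => // h hk.
by rewrite [_ + x]addrC; apply: fk => //; rewrite subrr normr0.
Qed.

End Gradients.

(** * Strongly convex smooth functions *)

Section StronglyConvexSmooth.
Context {R : realType} {d : nat} (f : 'rV[R]_d -> R) (mu L : R).
Implicit Types (x y z v : 'rV[R]_d).
Hypotheses (fC2 : C2 f) (mu0 : 0 < mu) (muL : mu <= L).
Hypothesis fhess : forall z, loewner_le mu%:M (hessian f z) /\
                             loewner_le (hessian f z) L%:M.

Let f1 x v (t : R) : R^o := dot (grad f (x + t *: v)) v.
Let f2 x v (t : R) : R^o := dot (v *m hessian f (x + t *: v)) v.

Let is_derive_line (g : 'rV[R]_d -> R^o) x v (t l : R) :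
  is_derive (x + t *: v) v g l -> is_derive t 1 (fun s : R => g (x + s *: v)) l.
Proof.
move=> /is_deriveP gl; apply/is_deriveP => e /gl[k k0 gk].
exists k => // h /gk.
by rewrite -[_%:A]/(h * 1) mulr1 scalerDl addrCA addrA.
Qed.

Let is_derive_f x v (t : R) :
  is_derive t 1 (fun s : R => f (x + s *: v) : R^o) (f1 x v t).
Proof.
by case: fC2 => df cf _ _; apply: is_derive_line; exact: C1_is_derive.
Qed.

Let is_derive_f1 x v (t : R) : is_derive t 1 (f1 x v) (f2 x v t).
Proof.
case: fC2 => _ _ df cf.
have dp j : is_derive t 1 (fun s : R => partial j f (x + s *: v))
    (dot (grad (partial j f) (x + t *: v)) v).
  by apply: is_derive_line; apply: C1_is_derive => *; [exact: df|exact: cf].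
have -> : f1 x v =
    \sum_j (v 0 j *: (fun s : R => partial j f (x + s *: v))).
  apply/funext => s; rewrite fct_sumE; apply: eq_bigr => j _.
  by rewrite mxE mulrC.
apply: is_derive_eq; rewrite /f2 /dot; apply: eq_bigr => j _.
rewrite [RHS]mulrC mxE; congr (_ * _); apply: eq_bigr => i _.
by rewrite !mxE mulrC.
Qed.

Let f2_bounds x v t : mu * dot v v <= f2 x v t <= L * dot v v.
Proof.
have [[_ /(_ v)] h [_ /(_ v)]] := fhess (x + t *: v).
move: h; rewrite !mulmxBr !mul_mx_scalar !dotE => h1 h2.
by rewrite /f2 -subr_ge0 h1 -subr_ge0 h2.
Qed.

Lemma quadratic_lower_bound x y :
  f x + dot (grad f x) (y - x) + mu / 2 * dot (y - x) (y - x) <= f y.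
Proof.
pose v := y - x.
have := @taylor2_ge _ _ _ _ (mu * dot v v) (is_derive_f x v) (is_derive_f1 x v)
  (fun t => proj1 (andP (f2_bounds x v t))).
by rewrite /f1 scale0r scale1r addr0 mulrAC /v subrKC.
Qed.

Lemma quadratic_upper_bound x y :
  f y <= f x + dot (grad f x) (y - x) + L / 2 * dot (y - x) (y - x).
Proof.
pose v := y - x.
have := @taylor2_ge _ (- _) _ _ (- (L * dot v v))
  (fun t => is_deriveN (is_derive_f x v t))
  (fun t => is_deriveN (is_derive_f1 x v t)).
have h t : - (L * dot v v) <= - f2 x v t.
  by rewrite lerN2; case/andP: (f2_bounds x v t).
move=> /(_ h); rewrite /f1 !fctE !scale0r !scale1r !addr0 /v subrKC; lra.
Qed.

Lemma first_order_bound x y : f x + dot (grad f x) (y - x) <= f y.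
Proof.
apply: le_trans (quadratic_lower_bound x y).
by rewrite lerDl mulr_ge0 ?dot_ge0// divr_ge0// ltW.
Qed.

(** A gradient step of length [L^-1] lowers [f] by at least [|grad f xs|^2 / (2 L)], which
    minimality forces to be 0. *)
Lemma grad_minimizer xs : minimizer f xs -> grad f xs = 0.
Proof.
move=> fmin; apply/eqP; rewrite -dot_eq0.
have L0 : 0 < L := lt_le_trans mu0 muL.
rewrite eq_le dot_ge0 andbT.
have := le_trans (fmin _) (quadratic_upper_bound xs (xs - L^-1 *: grad f xs)).
rewrite [xs + _ - _]addrC addKr !dotE -!addrA lerDl.
set q := dot _ _ => h.
rewrite -(pmulr_rle0 q (_ : 0 < L^-1 / 2)) ?divr_gt0 ?invr_gt0//.
have -> : L^-1 / 2 * q =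
  - (- (L^-1 * q) + L / 2 * - - (L^-1 * (L^-1 * q))) by field; rewrite gt_eqF.
by rewrite oppr_le0.
Qed.

(* Nesterov, Introductory Lectures on Convex Optimization, Theorem 2.1.12: the
   quadratic bounds make [f - mu/2 |.|^2] convex and [(L - mu)]-smooth, hence
   its gradient [(L - mu)^-1]-cocoercive; [w] is the increment of that
   gradient. *)
Lemma grad_coercive x y :
  dot (grad f y - grad f x) (grad f y - grad f x) + mu * L * dot (y - x) (y - x)
  <= (mu + L) * dot (grad f y - grad f x) (y - x).
Proof.
set g := grad f y - grad f x; set v := y - x; pose w := g - mu *: v.
have key (s : R) :
    2 * s * dot w w - (L - mu) * s ^+ 2 * dot w w <= dot w v.
  (* At each of [x + s *: w] and [y - s *: w], the lower bound from one endpoint is set against the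
     upper bound from the other; all values of [f] cancel in the sum. *)
  have := lerD (lerD (quadratic_lower_bound y (x + s *: w))
      (quadratic_upper_bound x (x + s *: w)))
    (lerD (quadratic_lower_bound x (y - s *: w))
      (quadratic_upper_bound y (y - s *: w))).
  rewrite [x + _ - x]addrC [y + _ - y]addrC !addKr.
  have -> : x + s *: w - y = s *: w - v by rewrite /v opprB addrCA addrA.
  have -> : y - s *: w - x = v - s *: w by rewrite /v addrAC.
  have -> : grad f y = w + mu *: v + grad f x by rewrite /w /g !subrK.
  clearbody v w.
  rewrite !dotE !(dotC v w) -[X in is_true X -> _]subr_ge0
    -[X in _ -> is_true X]subr_ge0.
  move: (dot w w) (dot w v) (dot v v) (dot (grad f x) w) (dot (grad f x) v)
    (f x) (f y) (f (x + s *: w)) (f (y - s *: w))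
    => ww wv vv gw gv fx fy fz fz1.
  set a := (X in is_true (0 <= X) -> _); set b := (X in _ -> is_true (0 <= X)).
  by have -> : a = b by rewrite /a /b; field.
clearbody g v.
suff : dot w w <= (L - mu) * dot w v.
  rewrite /w !dotE (dotC v g); lra.
move: muL; rewrite le_eqVlt => /predU1P[eqmL|ltmL].
  (* When [mu = L] the bound is linear in [s], so a large [s] forces [w] to vanish. *)
  have := key (dot w v / (2 * dot w w) + 1); rewrite -eqmL subrr !mul0r subr0.
  have [->//|w0] := eqVneq (dot w w) 0.
  have := dot_ge0 w; rewrite le_eqVlt eq_sym (negbTE w0)/= => wp.
  rewrite mulrDr mulr1 mulrDl (_ : 2 * (_ / _) * _ = dot w v); last by field.
  lra.
have lp : 0 < L - mu by rewrite subr_gt0.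
(* This [s] maximizes [2 * s - (L - mu) * s ^+ 2]. *)
have := key (L - mu)^-1.
rewrite -(ler_pM2l lp); apply: le_trans; rewrite le_eqVlt; apply/orP; left.
by apply/eqP; field; rewrite gt_eqF.
Qed.

End StronglyConvexSmooth.

(** * The rescaling factor *)

Section ConeRescaling.
Context {R : realType} {d : nat}.
Implicit Types (g m v : 'rV[R]_d).

Lemma le_sqrtr_of_sqr (a b : R) : a ^+ 2 <= b -> a <= Num.sqrt b.
Proof.
move=> ab; apply: le_trans (ler_norm a) _.
by rewrite -sqrtr_sqr; apply: ler_wsqrtr.
Qed.

(* In the plane, [C] and [S] are the cosine and sine of the angle between [g]
   and [v], [p] and [q] the components of [m] along and across [g], and [k] the
   half-chord cut by the line of [g] in the ball of radius [r] around [m]. *)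
Lemma planar_rescaling (M r c C S G p q k : R) :
  0 < c -> c <= C -> C ^+ 2 + S ^+ 2 = 1 ->
  0 <= M -> 0 <= r -> r <= c * M -> 0 <= p -> 0 <= k -> k <= p ->
  M ^+ 2 = p ^+ 2 + q ^+ 2 -> r ^+ 2 = k ^+ 2 + q ^+ 2 ->
  0 <= G -> G <= p + k ->
  M * (c * M - r) * (G * C) <= c * (M ^+ 2 - r ^+ 2) * (p * C - q * S).
Proof.
move=> c0 cC CS M0 r0 rM p0 k0 kp Mpq rkq G0 Gpk.
(* Cauchy-Schwarz in the plane against the unit vector [(C, S)]: the vector with components
   [q ^+ 2 + k * p] and [q * (p - k)] has length [M * r]. *)
have rot : C * (q ^+ 2 + k * p) + S * (q * (p - k)) <= M * r.
  rewrite -[leRHS]ger0_norm ?mulr_ge0// -sqrtr_sqr; apply: le_sqrtr_of_sqr.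
  rewrite exprMn Mpq rkq -[leRHS]mulr1 -CS -subr_ge0.
  have -> : (p ^+ 2 + q ^+ 2) * (k ^+ 2 + q ^+ 2) * (C ^+ 2 + S ^+ 2) -
    (C * (q ^+ 2 + k * p) + S * (q * (p - k))) ^+ 2 =
    (S * (q ^+ 2 + k * p) - C * (q * (p - k))) ^+ 2 by ring.
  exact: sqr_ge0.
have aux : M * (C * M - r) <= (p - k) * (p * C - q * S).
  have -> : M * (C * M - r) = C * M ^+ 2 - M * r by ring.
  rewrite Mpq; lra.
have C0 : 0 < C by apply: lt_le_trans cC.
have CMr : 0 <= C * M - r.
  by rewrite subr_ge0 (le_trans rM)// ler_wpM2r.
apply: (@le_trans _ _ (c * (p + k) * (M * (C * M - r)))).
  apply: (@le_trans _ _ (c * G * (M * (C * M - r)))).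
    have -> : M * (c * M - r) * (G * C) = M * G * (C * c * M - C * r) by ring.
    have -> : c * G * (M * (C * M - r)) = M * G * (C * c * M - c * r) by ring.
    by rewrite ler_wpM2l ?mulr_ge0// lerB// ler_wpM2r.
  by rewrite ler_wpM2r ?mulr_ge0// ler_wpM2l// ltW.
have -> : c * (M ^+ 2 - r ^+ 2) * (p * C - q * S) =
  c * (p + k) * ((p - k) * (p * C - q * S)) by rewrite Mpq rkq; ring.
by rewrite ler_wpM2l// mulr_ge0 ?addr_ge0// ltW.
Qed.

(** Split [m] and [v] along [g] and orthogonally to it. The parallel parts contribute exactly, and
    Cauchy-Schwarz bounds the orthogonal parts [w] and [u]. *)
Lemma dot_ge_planar g m v (p C : R) : g != 0 -> v != 0 ->
  p = dot g m / norm2 g -> C = dot g v / (norm2 g * norm2 v) ->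
  norm2 v * (p * C - Num.sqrt (norm2 m ^+ 2 - p ^+ 2) * Num.sqrt (1 - C ^+ 2))
    <= dot m v.
Proof.
move=> g0 v0 pE CE.
have G0 : 0 < norm2 g by rewrite lt_def norm2_eq0 g0 norm2_ge0.
have V0 : 0 < norm2 v by rewrite lt_def norm2_eq0 v0 norm2_ge0.
pose w := m - (p / norm2 g) *: g; pose u := v - (dot g v / norm2 g ^+ 2) *: g.
have gg : dot g g = norm2 g ^+ 2 by rewrite sqr_norm2.
have Nw : norm2 w = Num.sqrt (norm2 m ^+ 2 - p ^+ 2).
  rewrite norm2E; congr Num.sqrt; rewrite sqr_norm2 !dotE gg (dotC m g) pE.
  by field; rewrite gt_eqF.
have Nu : norm2 u = norm2 v * Num.sqrt (1 - C ^+ 2).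
  rewrite -[X in X * _]ger0_norm ?norm2_ge0// -sqrtr_sqr -sqrtrM ?sqr_ge0//.
  rewrite norm2E; congr Num.sqrt; rewrite !dotE gg (dotC v g) CE -(sqr_norm2 v).
  by field; rewrite !gt_eqF.
have -> : dot m v = norm2 v * (p * C) + dot w u.
  rewrite !dotE gg (dotC m g) pE CE; field; by rewrite !gt_eqF.
rewrite mulrBr lerD2l; have := cauchy_schwarz w u.
by rewrite ler_norml Nw Nu => /andP[+ _]; congr (_ <= _); ring.
Qed.

(** This is [<g, v> <= <alpha m, v>] with the denominator of [alpha] cleared. What is known of [g]
    is that it lies within [r] of [m] and makes with [v] an angle of cosine at least [c]; the plane
    case then suffices. *)
Lemma cone_rescaling g m v (r c : R) :
  0 < c -> c * norm2 g * norm2 v <= dot g v ->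
  norm2 (g - m) <= r -> r < c * norm2 m -> c <= 1 ->
  norm2 m * (c * norm2 m - r) * dot g v <=
    c * (norm2 m ^+ 2 - r ^+ 2) * dot m v.
Proof.
move=> c0 cone gmr rm c1.
have r0 : 0 <= r := le_trans (norm2_ge0 _) gmr.
have cM : c * norm2 m <= norm2 m by rewrite ler_piMl ?norm2_ge0.
have rM : r < norm2 m := lt_le_trans rm cM.
have [->|v0] := eqVneq v 0.
  by rewrite !dot0r !mulr0.
have g0 : g != 0.
  apply: contraTneq gmr => ->; rewrite sub0r -ltNge.
  by rewrite norm2E dotNl dotNr opprK -norm2E.
have G0 : 0 < norm2 g by rewrite lt_def norm2_eq0 g0 norm2_ge0.
have V0 : 0 < norm2 v by rewrite lt_def norm2_eq0 v0 norm2_ge0.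
pose p := dot g m / norm2 g; pose C := dot g v / (norm2 g * norm2 v).
have mv := @dot_ge_planar g m v p C g0 v0 erefl erefl.
set q := Num.sqrt _ in mv; set S := Num.sqrt _ in mv.
have gvE : dot g v = norm2 v * (norm2 g * C).
  by rewrite /C; field; rewrite !gt_eqF.
have cC : c <= C by rewrite /C ler_pdivlMr ?mulr_gt0// mulrA.
have C1 : C ^+ 2 <= 1.
  rewrite -[leLHS]real_normK ?num_real// expr_le1// /C normrM normfV.
  rewrite (gtr0_norm (mulr_gt0 G0 V0)) ler_pdivrMr ?mulr_gt0// mul1r.
  exact: cauchy_schwarz.
have CS : C ^+ 2 + S ^+ 2 = 1 by rewrite /S sqr_sqrtr ?subr_ge0// subrKC.
have pM : p ^+ 2 <= norm2 m ^+ 2.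
  rewrite -[leLHS]real_normK ?num_real// ler_sqr ?nnegrE ?norm2_ge0//.
  rewrite /p normrM normfV (gtr0_norm G0) ler_pdivrMr// mulrC.
  exact: cauchy_schwarz.
have Mpq : norm2 m ^+ 2 = p ^+ 2 + q ^+ 2.
  by rewrite /q sqr_sqrtr ?subr_ge0// subrKC.
have gmE : norm2 g ^+ 2 - 2 * norm2 g * p + norm2 m ^+ 2 <= r ^+ 2.
  have : norm2 (g - m) ^+ 2 <= r ^+ 2 by rewrite ler_sqr ?nnegrE ?norm2_ge0.
  apply: le_trans; rewrite !sqr_norm2 !dotE (dotC m g) /p le_eqVlt.
  by apply/orP; left; apply/eqP; field; rewrite gt_eqF.
(* By Pythagoras [|g - m|^2 = (|g| - p)^2 + q^2], so [|g|] is within the half-chord [k] of [p]. *)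
have qr : (norm2 g - p) ^+ 2 <= r ^+ 2 - q ^+ 2 by move: gmE; rewrite Mpq; lra.
have rq : 0 <= r ^+ 2 - q ^+ 2 := le_trans (sqr_ge0 _) qr.
pose k := Num.sqrt (r ^+ 2 - q ^+ 2).
have k2 : k ^+ 2 = r ^+ 2 - q ^+ 2 by rewrite sqr_sqrtr.
have k0 : 0 <= k := sqrtr_ge0 _.
have rM2 : r ^+ 2 < norm2 m ^+ 2 by rewrite ltr_sqr ?nnegrE ?norm2_ge0.
have p0 : 0 < p.
  rewrite -(pmulr_rgt0 _ G0); have := sqr_ge0 (norm2 g); lra.
have kp : k <= p.
  by rewrite -ler_sqr ?nnegrE ?(ltW p0)// k2; move: rM2; rewrite Mpq; lra.
have Gpk : norm2 g <= p + k.
  by rewrite -lerBlDl; exact: le_sqrtr_of_sqr.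
have rkq : r ^+ 2 = k ^+ 2 + q ^+ 2 by rewrite k2 subrK.
have := planar_rescaling c0 cC CS (norm2_ge0 m) r0 (ltW rm) (ltW p0) k0 kp
  Mpq rkq (ltW G0) Gpk.
rewrite -(ler_pM2l V0) => H.
rewrite gvE mulrCA (le_trans H)// mulrCA ler_wpM2l//.
by rewrite mulr_ge0 ?(ltW c0)// subr_ge0 ltW.
Qed.

End ConeRescaling.

(** * Finite differences of a strongly convex smooth function *)

Section FiniteDifferenceEstimate.
Context {R : realType} {d : nat} (f : 'rV[R]_d -> R) (mu L eps c : R).
Implicit Types (x xs : 'rV[R]_d).
Hypotheses (fC2 : C2 f) (mu0 : 0 < mu) (muL : mu <= L) (eps0 : 0 < eps).
Hypothesis fhess : forall z, loewner_le mu%:M (hessian f z) /\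
                             loewner_le (hessian f z) L%:M.
Hypothesis cE : c = 2 * Num.sqrt (mu * L) / (mu + L).

Lemma norm2_grad_sub_fd_m x : norm2 (grad f x - fd_m f eps x) <= fd_R f eps x.
Proof.
rewrite /fd_R !norm2E; apply: ler_wsqrtr; apply: ler_sum => i _.
have fo := first_order_bound fC2 mu0 fhess x.
have := fo (x - eps *: basis_vec i); have := fo (x + eps *: basis_vec i).
rewrite [x + _ - x]addrC [x - _ - x]addrC !addKr dotNr dotZr dot_basis_vec.
rewrite !mxE; set g := partial i f x.
set fp := f (x + _); set fm := f (x - _) => hp hm.
have e2 : 0 < 2 * eps by rewrite mulr_gt0.
have -> : g - (fp - fm) / (2 * eps) = (2 * eps * g - (fp - fm)) / (2 * eps).
  by field; rewrite gt_eqF.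
rewrite -!expr2 -[leLHS]real_normK ?num_real// normrM normfV (gtr0_norm e2).
(* The two tangent inequalities at [x], tested at [x + eps *: basis_vec i] and
   [x - eps *: basis_vec i], give one side each. *)
have a_le : `|2 * eps * g - (fp - fm)| <= fp + fm - 2 * f x.
  by rewrite ler_norml; apply/andP; split; lra.
rewrite ler_sqr ?nnegrE ?divr_ge0 ?(ltW e2) ?(le_trans _ a_le)//.
by rewrite ler_pM2r ?invr_gt0.
Qed.

Lemma cone_cosine_gt0 : 0 < c.
Proof.
have L0 := lt_le_trans mu0 muL.
by rewrite cE divr_gt0 ?addr_gt0// mulr_gt0// sqrtr_gt0 mulr_gt0.
Qed.

Lemma cone_cosine_le1 : c <= 1.
Proof.
have L0 := lt_le_trans mu0 muL.
rewrite cE ler_pdivrMr ?addr_gt0// mul1r.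
have s0 : 0 <= 2 * Num.sqrt (mu * L) by rewrite mulr_ge0 ?sqrtr_ge0.
have muL0 : 0 <= mu + L by rewrite addr_ge0// ltW.
have p0 : 0 <= mu * L by rewrite mulr_ge0// ltW.
rewrite -ler_sqr// exprMn sqr_sqrtr//.
have := sqr_ge0 (mu - L); lra.
Qed.

(** Since the gradient vanishes at [xs], coercivity bounds [G^2 + mu L V^2] by
    [(mu + L) <grad f x, x - xs>], and the arithmetic-geometric mean inequality bounds it below by
    [2 sqrt(mu L) G V]. *)
Lemma grad_cone xs x : minimizer f xs ->
  c * norm2 (grad f x) * norm2 (x - xs) <= dot (grad f x) (x - xs).
Proof.
move=> fmin; have L0 := lt_le_trans mu0 muL.
have := grad_coercive fC2 muL fhess xs x.
rewrite (grad_minimizer fC2 mu0 muL fhess fmin) subr0.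
rewrite -!sqr_norm2; set G := norm2 _; set V := norm2 _ => coer.
have -> : c * G * V = 2 * Num.sqrt (mu * L) * G * V / (mu + L).
  by rewrite cE; ring.
rewrite ler_pdivrMr ?addr_gt0// [leRHS]mulrC (le_trans _ coer)//.
have -> : mu * L = Num.sqrt (mu * L) ^+ 2 by rewrite sqr_sqrtr// mulr_ge0// ltW.
rewrite sqrtr_sqr ger0_norm ?sqrtr_ge0//.
have := sqr_ge0 (G - Num.sqrt (mu * L) * V); lra.
Qed.

Lemma gap_le_fd_Omega xs x : minimizer f xs -> ~ fd_V f eps c x ->
  f x - f xs <= dot (fd_Omega f eps c x) (x - xs).
Proof.
have c0 := cone_cosine_gt0.
move=> fmin /negP; rewrite -ltNge ltr_pdivrMr// mulrC => rM.
have r0 : 0 <= fd_R f eps x := norm2_ge0 _.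
have M0 : 0 < fd_M f eps x.
  by rewrite -(pmulr_rgt0 _ c0) (le_lt_trans r0).
apply: (@le_trans _ _ (dot (grad f x) (x - xs))).
  have := first_order_bound fC2 mu0 fhess x xs.
  rewrite -(opprB x xs) dotNr; lra.
rewrite /fd_Omega /fd_alpha dotZl [leRHS]mulrAC.
rewrite ler_pdivlMr ?mulr_gt0 ?subr_gt0// mulrC.
by have := cone_rescaling c0 (grad_cone x fmin) (norm2_grad_sub_fd_m x) rM
  cone_cosine_le1.
Qed.

End FiniteDifferenceEstimate.

(** * Legendre functions *)

Section LegendreFunctions.
Context {R : realType} {d : nat} (Phi : 'rV[R]_d -> R).
Implicit Types (x y z v : 'rV[R]_d).
Hypothesis Phi_legendre : legendre (EFin \o Phi).

Lemma legendre_differentiable x : differentiable (Phi : _ -> R^o) x.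
Proof.
have [_ _ _ [_ diffPhi _] _] := Phi_legendre.
apply: diffPhi; rewrite (_ : edom _ = setT) ?interiorT//.
by apply/seteqP; split => // z _; exact: ltry.
Qed.

Lemma legendre_is_derive x v :
  is_derive x v (Phi : _ -> R^o) (dot (grad Phi x) v).
Proof.
have dPhi := legendre_differentiable x; split; first exact: diff_derivable.
rewrite deriveE// {1}(row_sum_delta v) linear_sum /dot; apply: eq_bigr => i _.
by rewrite linearZ mxE /partial deriveE// mulrC.
Qed.

Lemma legendre_continuous : continuous (Phi : _ -> R^o).
Proof.
by move=> x; apply/differentiable_continuous/legendre_differentiable.
Qed.

Lemma legendre_convex x y (t : R) : 0 <= t <= 1 ->
  Phi (t *: x + (1 - t) *: y) <= t * Phi x + (1 - t) * Phi y.
Proof.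
move=> /andP[t0 t1]; have [_ cvxPhi _ _ _] := Phi_legendre.
have epi z : (z, Phi z : R^o) \in epigraph (EFin \o Phi).
  by rewrite inE /epigraph /=.
have := cvxPhi (x, Phi x : R^o) (y, Phi y : R^o) (Itv01 t0 t1) (epi x) (epi y).
by rewrite inE /epigraph /= lee_fin.
Qed.

Lemma legendre_first_order x y : Phi x + dot (grad Phi x) (y - x) <= Phi y.
Proof.
have /is_deriveP dPhi := legendre_is_derive x (y - x).
rewrite -lerBrDl; apply/ler_addgt0Pl => e /dPhi[k k0 Phik].
have [s s0 [sk s1]] : exists2 s : R, 0 < s & s < k /\ s <= 1.
  exists (Num.min (k / 2) 1); first by rewrite lt_min ltr01 divr_gt0.
  by rewrite gt_min ge_min lexx orbT; split=> //; rewrite ltr_pdivrMr//; lra.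
have := Phik s; rewrite gtr0_norm// => /(_ sk).
have -> : s *: (y - x) + x = s *: y + (1 - s) *: x.
  by rewrite scalerBr scalerBl scale1r [x - _]addrC addrA.
have : Phi (s *: y + (1 - s) *: x) <= s * Phi y + (1 - s) * Phi x.
  by apply: legendre_convex; rewrite (ltW s0).
rewrite ler_norml => h1 /andP[h2 _]; rewrite -(ler_pM2l s0); lra.
Qed.

(** The gradient is a subgradient at every point, so the domain of the subdifferential is the whole
    space and essential strict convexity applies there. *)
Lemma legendre_strictly_convex x y (t : R) : x != y -> 0 < t < 1 ->
  Phi (t *: x + (1 - t) *: y) < t * Phi x + (1 - t) * Phi y.
Proof.
move=> xy t01; have [_ _ _ _ scPhi] := Phi_legendre.
have cT : convex_set (setT : set (convex_lmodType 'rV[R]_d)).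
  by move=> *; rewrite inE.
have sT : setT `<=` dom_subdifferential (EFin \o Phi).
  move=> z _; exists (grad Phi z) => w.
  by rewrite /= -EFinD lee_fin legendre_first_order.
by have := scPhi _ cT sT x y t I I xy t01; rewrite /= -!EFinM -EFinD lte_fin.
Qed.

Lemma bregman_ge0 x y : 0 <= bregman Phi x y.
Proof. by rewrite /bregman -addrA -opprD subr_ge0 legendre_first_order. Qed.

(** The conjugate at [y] is minus the infimum of this function, and its critical points are the
    solutions of [grad Phi x = y]. *)
Let gap y x := Phi x - dot y x.

Let gap_continuous y : continuous (gap y : _ -> R^o).
Proof.
have dot_cont : continuous (dot y : _ -> R^o).
  apply: (@continuous_big R^o) => [|i _]; first exact: add_continuous.
  by move=> x; apply: cvgMl_tmp; [exact: nbhs_filter|exact: coord_continuous].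
move=> x; apply: continuousB; [exact: legendre_continuous|exact: dot_cont].
Qed.

Let gap_grad y xh : (forall x, gap y xh <= gap y x) -> grad Phi xh = y.
Proof.
move=> xhmin; apply/rowP => i; rewrite mxE.
have dPhi := legendre_is_derive xh (basis_vec i).
rewrite /partial derive_val; apply: (is_derive_ge_eq dPhi) => h.
have := xhmin (h *: basis_vec i + xh).
by rewrite /gap dotDr dotZr dot_basis_vec; lra.
Qed.

(** The conjugate is finite at [y] shifted by [k / 2] either way along each axis; the Fenchel-Young
    inequality at these points bounds each [|x_i|] by the gap. *)
Let int_dom_conjugate_coercive y : (edom (conjugate (EFin \o Phi)))° y ->
  exists k C : R, [/\ 0 < k, 0 <= C &
    forall x i, k * `|x 0 i| <= gap y x + C].
Proof.
move=> /nbhs_ballP[k /= k0 ballk].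
have k2 : 0 < k / 2 by rewrite divr_gt0.
have bnd (s : R) i : `|s| <= k / 2 ->
    exists C : R, forall x, s * x 0 i <= gap y x + C.
  move=> sk; have : edom (conjugate (EFin \o Phi)) (y + s *: basis_vec i).
    apply: ballk; rewrite -ball_normE /= opprD addNKr normrN.
    rewrite (@le_lt_trans _ _ (k / 2))//; last by rewrite ltr_pdivrMr//; lra.
    apply: rV_norm_le; first exact: ltW.
    move=> j; rewrite !mxE eqxx; case: eqP => _; first by rewrite mulr1.
    by rewrite mulr0 normr0 ltW.
  rewrite /edom /= => finC.
  have ub x : ((dot (y + s *: basis_vec i) x)%:E - (Phi x)%:E <=
      conjugate (EFin \o Phi) (y + s *: basis_vec i))%E.
    by apply: ereal_sup_ubound; exists x.
  move: finC ub; case: (conjugate _ _) => [C _ ub|//|_ ub].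
    exists C => x; have := ub x; rewrite -EFinB lee_fin dotDl dotZl.
    by rewrite (dotC _ x) (dotC _ x) !dot_basis_vec /gap dotC; lra.
  (* [edom] admits the value [-oo]; the finite value of [Phi] at 0 excludes it. *)
  by have := ub 0; rewrite leeNy_eq.
have {}bnd i : exists C : R, forall x, k / 2 * `|x 0 i| <= gap y x + `|C|.
  have [|C1 ub1] := bnd (k / 2) i; first by rewrite gtr0_norm.
  have [|C2 ub2] := bnd (- (k / 2)) i; first by rewrite normrN gtr0_norm.
  exists (`|C1| + `|C2|) => x; rewrite [X in _ + X]ger0_norm ?addr_ge0//.
  have := ub1 x; have := ub2 x.
  have := ler_norm C1; have := ler_norm C2.
  have : 0 <= `|C1| by []. have : 0 <= `|C2| by [].
  by case: (ger0P (x 0 i)) => _; lra.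
have /boolp.choice[C Cub] := bnd.
exists (k / 2), (\sum_i `|C i|); split => //; first exact: sumr_ge0.
move=> x i; apply: le_trans (Cub i x) _; rewrite lerD2l.
by rewrite (bigD1 i)//= lerDl sumr_ge0.
Qed.

(** Coercivity makes the sublevel set through 0 compact, so the continuous gap attains its minimum
    on it. *)
Let gap_minimum y : (edom (conjugate (EFin \o Phi)))° y ->
  exists xh, forall x, gap y xh <= gap y x.
Proof.
move=> /int_dom_conjugate_coercive[k [C [k0 C0 coer]]].
pose A := [set x : 'rV[R]_d | gap y x <= gap y 0].
have A0 : A 0 by rewrite /A /=.
have cA : compact A.
  apply: bounded_closed_compact.
    exists (`|gap y 0 + C| / k); split; first exact: num_real.
    move=> M kM x Ax; apply: le_trans (ltW kM).
    apply: rV_norm_le => [|i]; first by rewrite divr_ge0// ltW.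
    rewrite ler_pdivlMr// mulrC (le_trans (coer x i))//.
    by rewrite (le_trans _ (ler_norm _))// lerD2r.
  apply: (@closed_comp _ _ (gap y) [set r | r <= gap y 0]);
    last exact: closed_le.
  by move=> x _; exact: gap_continuous.
have [|xh /[!inE] Axh xhmin] := @EVT_min_rV _ _ (gap y) A (ex_intro _ 0 A0) cA.
  by apply: continuous_subspaceT => x; exact: gap_continuous.
exists xh => x; have [gx|/ltW gx] := leP (gap y x) (gap y 0).
  by apply: xhmin; rewrite inE.
exact: le_trans Axh gx.
Qed.

(* By convexity the gap grows at least linearly away from its unique
   minimizer, which bounds the supremum defining the conjugate near [y]. *)
Let gap_linear_growth y xh e : (forall x, gap y xh <= gap y x) -> 0 < e ->
  exists2 k : R, 0 < k &
    forall x, e <= `|x - xh| -> k * `|x - xh| <= gap y x - gap y xh.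
Proof.
move=> xhmin e0; pose S := [set x : 'rV[R]_d | `|x - xh| = e].
have cS : compact S.
  apply: bounded_closed_compact.
    exists (e + `|xh|); split; first exact: num_real.
    move=> M /ltW eM x Sx; apply: le_trans eM.
    by rewrite -(subrK xh x) (le_trans (ler_normD _ _))// Sx.
  apply: (@closed_comp _ _ (fun x => `|x - xh|) [set e]); last exact: closed_eq.
  move=> x _; have Fx := nbhs_filter x.
  by apply: cvg_norm; apply: cvgB; [exact: cvg_id|exact: cvg_cst].
have strict x : x != xh -> gap y xh < gap y x.
  move=> xxh; have h2 : 0 < (2^-1 : R) < 1 by lra.
  have := legendre_strictly_convex xxh h2.
  have := xhmin (2^-1 *: x + (1 - 2^-1) *: xh).
  rewrite /gap dotDr !dotZr; lra.
have [k k0 Sk] : exists2 k : R, 0 < k &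
    forall x, S x -> k <= gap y x - gap y xh.
  (* The sphere is empty when [d = 0]; any positive constant then serves. *)
  have [->|/set0P S0] := eqVneq S set0; first by exists 1.
  have [|z /[!inE] Sz zmin] := @EVT_min_rV _ _ (gap y) S S0 cS.
    by apply: continuous_subspaceT => x; exact: gap_continuous.
  exists (gap y z - gap y xh).
    rewrite subr_gt0; apply: strict; apply: contraTneq e0 => zxh.
    by rewrite -Sz zxh subrr normr0 ltxx.
  by move=> x Sx; rewrite lerD2r; apply: zmin; rewrite inE.
exists (k / e); first exact: divr_gt0.
move=> x ex; set n := `|x - xh|; have n0 : 0 < n := lt_le_trans e0 ex.
set t := e / n; have t01 : 0 <= t <= 1.
  by rewrite ler_pdivrMr// mul1r ex andbT ltW// divr_gt0.
(* The factor [t = e / n] is where the segment from [xh] to [x] crosses the sphere of radius [e]. *)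
have Sz : S (t *: x + (1 - t) *: xh).
  rewrite /S /= scalerBl scale1r addrCA -scalerBr addrAC subrr add0r.
  rewrite normrZ ger0_norm ?(andP t01).1// /t -/n; field; exact: lt0r_neq0.
have := legendre_convex x xh t01; have := Sk _ Sz.
rewrite {1}/gap dotDr !dotZr => h1 h2.
have : k <= t * (gap y x - gap y xh) by rewrite /gap in h1 *; lra.
have -> : k / e * n = k / t by rewrite /t; field; rewrite !gt_eqF.
by rewrite ler_pdivrMr ?divr_gt0// mulrC.
Qed.

(** The minimizer [xh] of the gap satisfies [grad Phi xh = y] and attains the conjugate at [y]; it
    remains to see that [xh] is also the gradient of the conjugate there. *)
Lemma conjugate_gradient y : (edom (conjugate (EFin \o Phi)))° y ->
  grad Phi (egrad (conjugate (EFin \o Phi)) y) = y.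
Proof.
move=> yint; have [xh xhmin] := gap_minimum yint.
have conj_ge z x : ((dot z x - Phi x)%:E <= conjugate (EFin \o Phi) z)%E.
  by rewrite EFinB; apply: ereal_sup_ubound; exists x.
have conj_le z (r : R) : (forall x, dot z x - Phi x <= r) ->
    (conjugate (EFin \o Phi) z <= r%:E)%E.
  by move=> zr; apply: ge_ereal_sup => _ [x _ <-]; rewrite /= -EFinB lee_fin.
have conjy : conjugate (EFin \o Phi) y = (dot y xh - Phi xh)%:E.
  apply/eqP; rewrite eq_le conj_ge andbT; apply: conj_le => x.
  by have := xhmin x; rewrite /gap; lra.
suff -> : egrad (conjugate (EFin \o Phi)) y = xh by exact: gap_grad.
apply/rowP => i; rewrite mxE /partial.
suff dconj : is_derive y (basis_vec i)
    (fun z => fine (conjugate (EFin \o Phi) z) : R^o) (xh 0 i)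
  by rewrite derive_val.
(* Testing the supremum at [xh] gives the lower estimate. For the upper one, [e] is both the error
   rate and a radius: beyond distance [e] from [xh] the growth of the gap absorbs the perturbation
   because [|h| < k], and within it the perturbation is at most [e * |h|]. *)
apply/is_deriveP => e e0; have [k k0 growth] := gap_linear_growth xhmin e0.
exists k => // h hk; set z := h *: basis_vec i + y.
have zE x : dot z x = h * x 0 i + dot y x.
  by rewrite dotDl dotZl dotC dot_basis_vec.
have lo := conj_ge z xh.
have up : (conjugate (EFin \o Phi) z <=
    (dot y xh - Phi xh + h * xh 0 i + e * `|h|)%:E)%E.
  apply: conj_le => x; rewrite zE.
  suff : h * (x - xh) 0 i <= gap y x - gap y xh + e * `|h|.
    by rewrite !mxE /gap; lra.
  have hx : h * (x - xh) 0 i <= `|h| * `|x - xh|.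
    by rewrite (le_trans (ler_norm _))// normrM ler_wpM2l// rV_norm_coord.
  apply: (le_trans hx); have [xe|/ltW xe] := leP e `|x - xh|.
    rewrite (@le_trans _ _ (k * `|x - xh|))//; first by rewrite ler_wpM2r// ltW.
    by rewrite (le_trans (growth x xe))// lerDl mulr_ge0// ltW.
  rewrite mulrC (@le_trans _ _ (e * `|h|))//; first by rewrite ler_wpM2r.
  by rewrite lerDr subr_ge0.
rewrite conjy /=; move: lo up; rewrite zE.
case: (conjugate _ z) => [r|//|//]; rewrite !lee_fin /= => lo up.
have : 0 <= e * `|h| by rewrite mulr_ge0// ltW.
by rewrite ler_norml; lra.
Qed.

End LegendreFunctions.

(** * Mirror descent *)

Section MirrorDescent.
Context {R : realType} {d : nat} (f Phi : 'rV[R]_d -> R).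
Implicit Types (x y u : 'rV[R]_d) (eta : R).
Hypothesis Phi_legendre : legendre (EFin \o Phi).

(** The comparison point [u] is left free: the minimizer gives the telescoping bound, and the
    current iterate gives monotonicity. *)
Lemma mirror_step_decrease (Omega : 'rV[R]_d -> 'rV[R]_d) eta x y u :
  0 < eta -> admissible Phi Omega x eta -> y = mirror_step Phi Omega eta x ->
  eta * gen_bregman f Omega y x <= bregman Phi y x ->
  f x - f u <= dot (Omega x) (x - u) ->
  eta * (f y - f u) <= bregman Phi u x - bregman Phi u y.
Proof.
move=> eta0 adm yE step gap.
have gradE : grad Phi y = grad Phi x - eta *: Omega x.
  by rewrite yE; exact: conjugate_gradient.
have : eta * (f x - f u) <= eta * dot (Omega x) (x - u) by rewrite ler_pM2l.
move: step; rewrite /gen_bregman /bregman gradE !dotE; lra.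
Qed.

Lemma mirror_descent_rate (Omega : 'rV[R]_d -> 'rV[R]_d) u (t : nat)
    (x : nat -> 'rV[R]_d) (eta : nat -> R) : (2 <= t)%N ->
  (forall j, (1 <= j < t)%N ->
    [/\ 0 < eta j, admissible Phi Omega (x j) (eta j),
        x j.+1 = mirror_step Phi Omega (eta j) (x j),
        eta j * gen_bregman f Omega (x j.+1) (x j) <= bregman Phi (x j.+1) (x j) &
        f (x j) - f u <= dot (Omega (x j)) (x j - u)]) ->
  f (x t) - f u <= bregman Phi u (x 1%N) / \sum_(1 <= j < t) eta j.
Proof.
move=> t2 run.
(* With [u := x j] the gap hypothesis reads [0 <= 0]. *)
have mono j : (1 <= j < t)%N -> f (x j.+1) <= f (x j).
  move=> /run[eta0 adm xE step _].
  have := @mirror_step_decrease _ _ _ _ (x j) eta0 adm xE step.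
  have -> : bregman Phi (x j) (x j) = 0.
    by rewrite /bregman !subrr dot0r subrr.
  rewrite !subrr dot0r sub0r => /(_ (lexx 0)) dec.
  rewrite -subr_le0 -(pmulr_rle0 _ eta0) (le_trans dec)// oppr_le0.
  exact: bregman_ge0.
have last_min j : (1 <= j <= t)%N -> f (x t) <= f (x j).
  move=> /andP[j1 jt]; move: (leqnn t); rewrite -{1 3}(subnKC jt).
  elim: (t - j)%N => [|k ih]; rewrite ?addn0// addnS => jkt.
  apply: le_trans (ih (ltnW jkt)); apply: mono.
  by rewrite jkt andbT (leq_trans j1)// leq_addr.
have sum_gt0 : 0 < \sum_(1 <= j < t) eta j.
  rewrite big_ltn// ltr_pwDl//; first by have [|] := run 1%N; rewrite // t2.
  rewrite big_nat sumr_ge0// => j /andP[j1 jt].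
  by have [|/ltW] := run j; rewrite // jt andbT ltnW.
rewrite ler_pdivlMr// mulrC mulr_suml.
(* Every [f (x j.+1)] in the telescoping bound is at least [f (x t)], so the rate holds for the last
   iterate. *)
apply: (@le_trans _ _ (\sum_(1 <= j < t)
    (bregman Phi u (x j) - bregman Phi u (x j.+1)))).
  apply: ler_sum_nat => j j1t; have [eta0 adm xE step gap] := run j j1t.
  apply: le_trans (mirror_step_decrease eta0 adm xE step gap).
  rewrite ler_pM2l// lerD2r; apply: last_min.
  by case/andP: j1t.
rewrite -[leLHS]opprK -sumrN (eq_bigr (fun j => bregman Phi u (x j.+1)
  - bregman Phi u (x j))) => [|j _]; last by rewrite opprB.
rewrite telescope_sumr ?(ltnW t2)// opprB gerBl.
exact: bregman_ge0.
Qed.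

End MirrorDescent.

(** * First stopping index and returned point *)

Section FirstStop.
Context {R : realType} {d : nat} (V : set 'rV[R]_d).
Variables (x : nat -> 'rV[R]_d) (t : nat).

Lemma first_stop_or_no_stop :
  (exists2 tau, (tau <= t)%N & first_stop V x tau) \/ no_stop_through V x t.
Proof.
have [|] := pselect (exists j, (1 <= j)%N && `[< V (x j) >]) => [ex|nex].
  case: (ex_minnP ex) => tau /andP[tau1 /asboolP Vtau] tau_min.
  (* The least stopping index of the whole sequence may exceed [t]; there is then no stop through
     [t]. *)
  have [taut|ttau] := leqP tau t; [left; exists tau => //; split=> //|right];
    move=> j /andP[j1 jle] Vj; have : (tau <= j)%N;
    by [apply: tau_min; rewrite j1; apply/asboolP|lia].
by right => j /andP[j1 _] Vj; apply: nex; exists j; rewrite j1; apply/asboolP.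
Qed.

Lemma returned_point_first_stop tau : (tau <= t)%N -> first_stop V x tau ->
  returned_point V x t = x tau.
Proof.
move=> taut [tau1 Vtau nstop]; rewrite /returned_point.
set a := fun j => _; set k := find a _.
suff -> : k = tau.-1 by rewrite prednK//; congr x; exact/minn_idPr.
have at_tau : a tau by exact/asboolP.
have has_a : has a (iota 1 t).
  by apply/hasP; exists tau => //; rewrite mem_iota tau1 add1n ltnS.
have kt : (k < t)%N by rewrite -[ltnRHS](size_iota 1) -has_find.
(* Position [k] of [iota 1 t] holds [k.+1], hence the shift between [k] and [tau]. *)
have := nth_find 0%N has_a; rewrite -/k nth_iota// add1n => /asboolP Vk.
apply/eqP; rewrite eqn_leq; apply/andP; split; rewrite leqNgt; apply/negP => lt.
  have := before_find 0%N lt.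
  rewrite nth_iota; last by rewrite (leq_trans _ taut) ?prednK.
  by rewrite add1n prednK// at_tau.
by apply: (nstop k.+1).
Qed.

Lemma returned_point_no_stop : no_stop_through V x t ->
  returned_point V x t = x t.
Proof.
move=> nstop; rewrite /returned_point hasNfind ?size_iota.
  by congr x; apply/minn_idPl.
apply/hasPn => j; rewrite mem_iota add1n ltnS => /nstop Vj.
exact/asboolPn.
Qed.

End FirstStop.

Theorem theorem6p3 (R : realType) (d : nat) (mu L : R)
    (f : 'rV[R]_d -> R) (xs : 'rV[R]_d) (eps c : R)
    (Phi : 'rV[R]_d -> R) (t : nat)
    (x : nat -> 'rV[R]_d) (eta : nat -> R)
    (hmu : 0 < mu) (hmuL : mu <= L)
    (hfC2 : C2 f)
    (hfconv : convex_function setT f)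
    (hfhess : forall z, loewner_le mu%:M (hessian f z) /\
                        loewner_le (hessian f z) L%:M)
    (hxs : minimizer f xs)
    (heps : 0 < eps)
    (hc : c = 2 * Num.sqrt (mu * L) / (mu + L))
    (hPhi : legendre (EFin \o Phi))
    (ht : (2 <= t)%N)
    (hrun : fd_run f Phi eps c t x eta)
    (hstep : forall j, performed (fd_V f eps c) x t j ->
       eta j * gen_bregman f (fd_Omega f eps c) (x j.+1) (x j)
         <= bregman Phi (x j.+1) (x j)) :
  ((exists tau, [/\ (tau <= t)%N, first_stop (fd_V f eps c) x tau &
      ((f (x tau) - f xs)%:E <= sup_gap f xs (fd_V f eps c))%E])
   \/
   (no_stop_through (fd_V f eps c) x t /\
    f (x t) - f xs <= bregman Phi xs (x 1%N) / \sum_(1 <= j < t) eta j))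
  /\
  ((f (returned_point (fd_V f eps c) x t) - f xs)%:E <=
     (if `[< exists2 tau, (tau <= t)%N & first_stop (fd_V f eps c) x tau >]
      then sup_gap f xs (fd_V f eps c)
      else Order.max (bregman Phi xs (x 1%N) / \sum_(1 <= j < t) eta j)%:E
                     (sup_gap f xs (fd_V f eps c))))%E.
Proof.
have stop tau : first_stop (fd_V f eps c) x tau ->
    ((f (x tau) - f xs)%:E <= sup_gap f xs (fd_V f eps c))%E.
  by case=> _ Vtau _; apply: ereal_sup_ubound; exists (x tau).
have go : no_stop_through (fd_V f eps c) x t ->
    f (x t) - f xs <= bregman Phi xs (x 1%N) / \sum_(1 <= j < t) eta j.
  move=> nstop; apply: (mirror_descent_rate hPhi ht) => j /andP[j1 jt].
  (* Absence of stopping through [t] makes every step before [t] a performed one, so the run and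
     step hypotheses apply to it. *)
  have perf : performed (fd_V f eps c) x t j.
    split; first by rewrite j1.
    move=> i /andP[i1 ij]; apply: nstop.
    by rewrite i1 (leq_trans ij)// ltnW.
  have [eta0 adm xE] := hrun j perf.
  split; [exact: eta0|exact: adm|exact: xE|exact: hstep|].
  apply: (gap_le_fd_Omega hfC2 hmu hmuL heps hfhess hc hxs).
  by apply: nstop; rewrite j1 ltnW.
split.
  have [[tau taut ftau]|nstop] := first_stop_or_no_stop (fd_V f eps c) x t.
    by left; exists tau; split => //; exact: stop.
  by right; split => //; exact: go.
case: asboolP => [[tau taut ftau]|nfirst].
  by rewrite (returned_point_first_stop taut ftau); exact: stop.
have [//|nstop] := first_stop_or_no_stop (fd_V f eps c) x t.
rewrite returned_point_no_stop//.
by rewrite le_max lee_fin go.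
Qed.
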